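(* There is a randomized non-adaptive algorithm that, for any $\delta>0$ and $B\ge 1$, recovers any hidden $B$-balanced $k$-clustering of an $n$-point universe with probability at least $1-\delta$ using $O(B^2 n\log(k/\delta)) + O(Bk\log^4(k/\delta))$ subset queries on sets of size $O(k\log k)$. In particular, for $\delta=1/\mathrm{poly}(k)$, any constant $B\ge 1$, and $k=O(n/\log^3 n)$, the query complexity is $O(n\log k)$.
   Context: Let $U$ be a set of $n$ points with a hidden partition $U=C_1\sqcup\cdots\sqcup C_k$. For $B\ge 1$ the partition is $B$-balanced if $\frac{n}{Bk}\le |C_i|\le \frac{Bn}{k}$ for all $i\in[k]$. A subset query on $S\subseteq U$ returns $\mathsf{count}(S)=|\{i\in[k]: C_i\cap S\neq\emptyset\}|$. Non-adaptive means the (possibly random) queries are fixed before any answer is seen. *)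

(* Defs.v *)
From mathcomp Require Export all_boot all_order all_algebra.
From mathcomp Require Export reals exp.

Set Implicit Arguments.
Unset Strict Implicit.
Unset Printing Implicit Defensive.

Import Order.TTheory GRing.Theory Num.Theory.
Local Open Scope ring_scope.

Definition clustering (n k : nat) (P : {set {set 'I_n}}) : bool :=
  finset.partition P [set: 'I_n] && (#|P| == k).

Definition balanced (R : realType) (n k : nat) (B : R)
    (P : {set {set 'I_n}}) : Prop :=
  forall C : {set 'I_n}, C \in P ->
    n%:R / (B * k%:R) <= #|C|%:R :> R /\ #|C|%:R <= B * n%:R / k%:R :> R.

Definition subset_count (n : nat) (P : {set {set 'I_n}}) (S : {set 'I_n}) : nat :=
  #|[set C in P | C :&: S != set0]|.

(* The seed is the algorithm's internal randomness, drawn from the distribution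
   [seed_pr]. Non-adaptivity: the whole list of queries is a function of the
   seed alone; only [decode] sees the answers. *)
Record nonadaptive_alg (R : realType) (n : nat) := NonadaptiveAlg {
  seed : finType;
  seed_pr : seed -> R;
  seed_pr_ge0 : forall w : seed, 0 <= seed_pr w;
  seed_pr_sum1 : \sum_(w : seed) seed_pr w = 1;
  nqueries : nat;
  queries : seed -> nqueries.-tuple {set 'I_n};
  decode : seed -> nqueries.-tuple nat -> {set {set 'I_n}}
}.

Definition output (R : realType) (n : nat) (A : nonadaptive_alg R n)
    (P : {set {set 'I_n}}) (w : seed A) : {set {set 'I_n}} :=
  decode w (map_tuple (subset_count P) (queries w)).

Definition success_pr (R : realType) (n : nat) (A : nonadaptive_alg R n)
    (P : {set {set 'I_n}}) : R :=
  \sum_(w : seed A | output P w == P) seed_pr w.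

(* delta(k) = 1/poly(k): delta is positive and 1/delta is bounded by a
   polynomial in k. *)
Definition inverse_poly (R : realType) (delta : nat -> R) : Prop :=
  (forall k : nat, (0 < k)%N -> 0 < delta k) /\
  exists (a : R) (c : nat), forall k : nat, (0 < k)%N ->
    (delta k)^-1 <= a * k%:R ^+ c.

(* Main.v *)
Require Import Defs.
From mathcomp Require Import all_boot all_order all_algebra.
From mathcomp Require Import reals exp.
From mathcomp Require Import sequences ring lra.

(** Draw [m] random sets [S_1, ..., S_m], each consisting of about [k / 4B]
    independent uniform points, and query [x |: S_j] for every point [x] and
    every [j]. The answer exceeds [count(S_j)] by one exactly when the cluster
    of [x] misses [S_j], so two points of the same cluster receive the same
    [m] answers, and two points of clusters [C != D] are told apart as soon as
    some [S_j] meets exactly one of [C] and [D]. This happens in particular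
    when exactly one sample lands in [C :|: D], which by balance has
    probability at least [1 / 4B^2]. A union bound over the [k^2] pairs of
    clusters shows that [m = O(B^2 log(k/delta))] sets suffice. *)

Set Implicit Arguments.
Unset Strict Implicit.
Unset Printing Implicit Defensive.

Import Order.TTheory GRing.Theory Num.Theory.
Local Open Scope ring_scope.

(** * Answer signatures of points and separation of clusters *)

Definition points (n s : nat) (f : {ffun 'I_s -> 'I_n}) : {set 'I_n} :=
  [set f i | i : 'I_s].

Lemma card_points (n s : nat) (f : {ffun 'I_s -> 'I_n}) : (#|points f| <= s)%N.
Proof. by rewrite -{2}(card_ord s); apply: leq_imset_card. Qed.

Definition separates (n : nat) (S C D : {set 'I_n}) : bool :=
  (C :&: S == set0) != (D :&: S == set0).

(** [pblock P x] is the only block containing [x], hence the only one that [x] can add to the blocks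
    met by [S]. *)
Lemma subset_count_setU1 (n : nat) (P : {set {set 'I_n}}) (x : 'I_n)
    (S : {set 'I_n}) :
  finset.partition P [set: 'I_n] ->
  subset_count P (x |: S) =
    ((pblock P x :&: S == set0) + subset_count P S)%N.
Proof.
move=> /and3P[/eqP covP tP nP].
have xP : pblock P x \in P by apply: pblock_mem; rewrite covP inE.
have xx : x \in pblock P x by rewrite mem_pblock covP inE.
rewrite /subset_count.
have -> : [set C in P | C :&: (x |: S) != set0] =
          pblock P x |: [set C in P | C :&: S != set0].
  apply/setP => C; rewrite !inE setIUr setU_eq0 negb_and.
  have [->|neC] := eqVneq C (pblock P x).
    rewrite xP /=; apply/orP; left.
    by apply/set0Pn; exists x; rewrite !inE xx eqxx.
  rewrite orFb; case CP: (C \in P) => //=.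
  suff -> : C :&: [set x] = set0 by rewrite eqxx.
  apply/setP => y; rewrite !inE; apply/negP => /andP[yC /eqP yx].
  by rewrite yx in yC; rewrite (def_pblock tP CP yC) eqxx in neC.
by rewrite cardsU1 !inE xP /= negbK.
Qed.

(** The summand [subset_count P (S j)] is common to all points and cancels when two signatures are
    compared. What remains at [j] is whether the block misses [S j], so the signature has the same
    fibres as [pblock P]. *)
Lemma preim_partition_signature (n m : nat) (P : {set {set 'I_n}})
    (S : 'I_m -> {set 'I_n}) :
  finset.partition P [set: 'I_n] ->
  (forall C D, C \in P -> D \in P -> C != D ->
     exists j, separates (S j) C D) ->
  preim_partition (fun x => [ffun j => subset_count P (x |: S j)])
    [set: 'I_n] = P.
Proof.
move=> partP sepP; rewrite -[RHS](preim_partition_pblock partP).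
have pP x : pblock P x \in P.
  by apply: pblock_mem; case/and3P: partP => /eqP->; rewrite inE.
apply: eq_imset => x; apply/setP => y; rewrite !inE /=.
apply/eqP/eqP => [/ffunP sig|eqxy]; last first.
  by apply/ffunP => j; rewrite !ffunE !subset_count_setU1 // eqxy.
apply/eqP; apply/negP => /negP nexy.
have [j] := sepP _ _ (pP x) (pP y) nexy.
move/(_ j): sig; rewrite !ffunE !subset_count_setU1 // => /addIn.
by rewrite /separates; do 2!case: (_ == set0).
Qed.

(** A subset of [C :|: D] can meet the sample only in [f i], and by disjointness [f i] lies in
    exactly one of [C] and [D]. *)
Lemma separates_single_hit (n s : nat) (f : {ffun 'I_s -> 'I_n})
    (C D : {set 'I_n}) (i : 'I_s) :
  [disjoint C & D] ->
  (forall j, (f j \in C :|: D) = (j == i)) -> separates (points f) C D.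
Proof.
move=> dCD single.
have hitE (A : {set 'I_n}) : A \subset C :|: D ->
    (A :&: points f == set0) = (f i \notin A).
  move=> /subsetP sA; apply/idP/idP => [/eqP A0|fiA].
    apply/negP => fiA; have : f i \in A :&: points f.
      by rewrite inE fiA imset_f.
    by rewrite A0 inE.
  apply/eqP/setP => y; rewrite !inE; apply/negP => /andP[yA /imsetP[j _ yj]].
  have := single j; rewrite -yj sA // => /esym/eqP ji.
  by rewrite -ji -yj yA in fiA.
rewrite /separates !hitE ?subsetUl ?subsetUr //.
have := single i; rewrite eqxx inE.
case fiC: (f i \in C) => //=; last by move=> ->.
by rewrite (disjointFr dCD fiC).
Qed.

(** For distinct [i] the events that sample [i] alone lands in [D] are disjoint, and each has
    [#|D| * (n - #|D|) ^ s] elements. *)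
Lemma card_single_hit (n s : nat) (D : {set 'I_n}) :
  (s.+1 * (#|D| * (n - #|D|) ^ s) <=
   #|[set f : {ffun 'I_s.+1 -> 'I_n} |
       [exists i, [forall j, (f j \in D) == (j == i)]]]|)%N.
Proof.
pose E (i : 'I_s.+1) :=
  [set f : {ffun 'I_s.+1 -> 'I_n} | [forall j, (f j \in D) == (j == i)]].
have cardE i : #|E i| = (#|D| * (n - #|D|) ^ s)%N.
  (* For fixed [i] the event is a product set, with factor [D] at [i] and its complement
     elsewhere. *)
  pose F j := if j == i then D else ~: D.
  have -> : #|E i| = #|(family F : pred _)|.
    apply: eq_card => f; rewrite !inE; apply: eq_forallb => j.
    rewrite -[RHS]/(f j \in F j) /F.
    by case: (j == i); rewrite ?inE; case: (f j \in D).
  have cardF j : #|F j| = if j == i then #|D| else (n - #|D|)%N.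
    by rewrite /F; case: (j == i) => //; rewrite cardsCs setCK card_ord.
  rewrite card_family foldrE big_map big_enum /= (bigD1 i) //= cardF eqxx.
  congr (_ * _)%N.
  rewrite (eq_bigr (fun=> (n - #|D|)%N)); last first.
    by move=> j /negPf nji; rewrite cardF nji.
  by rewrite prod_nat_const cardC1 card_ord.
have -> : (s.+1 * (#|D| * (n - #|D|) ^ s) = \sum_i #|E i|)%N.
  by under eq_bigr do rewrite cardE; rewrite sum_nat_const card_ord.
under eq_bigr do rewrite -sum1_card big_mkcond /=.
(* After the exchange of sums it remains to see that each [f] is counted for at most one [i]. *)
rewrite exchange_big -sum1_card [leqRHS]big_mkcond /=; apply: leq_sum => f _.
rewrite [in leqRHS]inE; case: ifPn => [/existsP[i fi]|nf]; last first.
  rewrite big1 // => i _; case: ifP => // fE; case/negP: nf.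
  by move: fE; rewrite !inE => fE; apply/existsP; exists i.
rewrite (bigD1 i) //= big1 ?addn0; first by case: ifP.
move=> j nji; case: ifP => //; rewrite inE => /forallP /(_ j) /eqP fj.
by move/forallP/(_ j)/eqP: fi; rewrite fj eqxx (negPf nji).
Qed.

Lemma bernoulli_ineq (R : realFieldType) (r : R) (s : nat) :
  0 <= r -> r <= 1 -> 1 - s%:R * r <= (1 - r) ^+ s.
Proof.
move=> r0 r1; elim: s => [|s IH]; first by rewrite expr0 mul0r subr0.
rewrite exprS -natr1.
have s0 : 0 <= s%:R * (r * r) by rewrite !mulr_ge0.
apply: le_trans (ler_wpM2l _ IH); [nra|lra].
Qed.

Lemma leq_card_bigcup (I T : finType) (A : {set I}) (F : I -> {set T}) :
  (#|\bigcup_(i in A) F i| <= \sum_(i in A) #|F i|)%N.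
Proof.
elim/big_rec2: _ => [|i a E _ IH]; first by rewrite cards0.
by apply: leq_trans (leq_card_setU _ _) _; rewrite leq_add2l.
Qed.

(** * Probability that random samples separate two clusters *)

Section SeparationProbability.

Variables (R : realType) (n k s : nat) (B : R) (P : {set {set 'I_n}}).
Hypotheses (n_gt0 : (0 < n)%N) (k_gt0 : (0 < k)%N) (B_ge1 : 1 <= B).
Hypotheses (partP : clustering k P) (balP : balanced k B P).
Hypotheses (s_le : s%:R <= k%:R / (4 * B)) (s_ge : k%:R / (4 * B) <= s.+1%:R).

(** With [r = #|C :|: D| / n], a single hit has probability at least [s.+1 * r * (1 - r) ^+ s].
    Balance gives [2 / (B k) <= r <= 2 B / k]. The lower bounds on [s.+1] and [r] make the first two
    factors at least [1 / (2 B^2)]; the upper bounds give [s * r <= 1 / 2], so the last factor is at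
    least [1 / 2] by Bernoulli. *)
Lemma card_separates (C D : {set 'I_n}) : C \in P -> D \in P -> C != D ->
  (4 * B ^+ 2)^-1 * n%:R ^+ s.+1 <=
  #|[set f : {ffun 'I_s.+1 -> 'I_n} | separates (points f) C D]|%:R :> R.
Proof.
move=> CP DP neCD.
have dCD : [disjoint C & D].
  by case/andP: partP => /and3P[_ /trivIsetP tP _] _; apply: tP.
pose d := #|C :|: D|.
have dE : d = (#|C| + #|D|)%N by rewrite /d cardsU disjoint_setI0 // cards0 subn0.
have dn : (d <= n)%N by rewrite -[leqRHS]card_ord max_card.
have N0 : 0 < n%:R :> R by rewrite ltr0n.
have K0 : 0 < k%:R :> R by rewrite ltr0n.
have B0 : 0 < B := lt_le_trans ltr01 B_ge1.
pose r : R := d%:R / n%:R.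
have r_ge : 2 / (B * k%:R) <= r.
  have [h1 _] := balP CP; have [h2 _] := balP DP.
  rewrite /r ler_pdivlMr // dE natrD.
  apply: le_trans (lerD h1 h2).
  by rewrite mulrAC -mulrA -[2]/(1 + 1) mulrDl !mul1r.
have r_le : r <= 2 * B / k%:R.
  have [_ h1] := balP CP; have [_ h2] := balP DP.
  rewrite /r ler_pdivrMr // dE natrD.
  apply: le_trans (lerD h1 h2) _.
  by rewrite le_eqVlt; apply/orP; left; apply/eqP; field; rewrite gt_eqF.
have r1 : r <= 1 by rewrite /r ler_pdivrMr // mul1r ler_nat.
have r0 : 0 <= r by rewrite /r divr_ge0.
have half : 1 / 2 <= (1 - r) ^+ s.
  apply: le_trans (bernoulli_ineq s r0 r1).
  have : s%:R * r <= k%:R / (4 * B) * (2 * B / k%:R).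
    by apply: ler_pM.
  have -> : k%:R / (4 * B) * (2 * B / k%:R) = 1 / 2 :> R.
    by field; rewrite !gt_eqF.
  lra.
have -> : (4 * B ^+ 2)^-1 = (k%:R / (4 * B)) * (2 / (B * k%:R)) * (1 / 2) :> R.
  by field; rewrite !gt_eqF.
apply: (@le_trans _ _ (s.+1%:R * r * (1 - r) ^+ s * n%:R ^+ s.+1)).
  rewrite ler_wpM2r ?exprn_ge0 //.
  have p1 : 0 <= k%:R / (4 * B) by apply: le_trans s_le.
  have p2 : 0 <= 2 / (B * k%:R) by rewrite divr_ge0 // mulr_ge0 // ltW.
  apply: ler_pM => //; [exact: mulr_ge0|by rewrite divr_ge0|exact: ler_pM].
have -> : s.+1%:R * r * (1 - r) ^+ s * n%:R ^+ s.+1 =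
    (s.+1 * (d * (n - d) ^ s))%:R :> R.
  rewrite !natrM natrX natrB // exprS.
  have -> : n%:R - d%:R = (1 - r) * n%:R :> R.
    by rewrite mulrBl mul1r /r divfK // gt_eqF.
  rewrite exprMn -(divfK (lt0r_neq0 N0) d%:R) -/r; ring.
rewrite ler_nat; apply: leq_trans (card_single_hit s (C :|: D)) _.
apply: subset_leq_card; apply/subsetP => f; rewrite !inE.
move=> /existsP[i /forallP fi]; apply: (separates_single_hit (i := i)) => //.
by move=> j; apply/eqP.
Qed.

(** The [m] samples are independent, so the failing seeds form an [m]-fold power, and each factor
    has proportion at most [1 - 1 / (4 B^2) <= expR (- 1 / (4 B^2))]. *)
Lemma card_never_separates (m : nat) (C D : {set 'I_n}) :
  C \in P -> D \in P -> C != D ->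
  #|[set w : {ffun 'I_m -> {ffun 'I_s.+1 -> 'I_n}} |
      [forall j, ~~ separates (points (w j)) C D]]|%:R <=
  expR (- (m%:R / (4 * B ^+ 2))) *
  #|{ffun 'I_m -> {ffun 'I_s.+1 -> 'I_n}}|%:R :> R.
Proof.
move=> CP DP neCD.
pose T := {ffun 'I_s.+1 -> 'I_n}.
pose G := [set f : T | separates (points f) C D].
have cT : #|T| = (n ^ s.+1)%N by rewrite card_ffun !card_ord.
have -> : #|[set w : {ffun 'I_m -> T} |
    [forall j, ~~ separates (points (w j)) C D]]| = (#|~: G| ^ m)%N.
  rewrite -[m in RHS]card_ord -card_ffun_on; apply: eq_card => w.
  by rewrite !inE; apply: eq_forallb => j; rewrite !inE.
rewrite card_ffun card_ord -/T !natrX -mulrN expRM_natl -exprMn.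
apply: lerXn2r; rewrite ?nnegrE ?mulr_ge0 ?expR_ge0 //.
rewrite cardsCs setCK natrB ?max_card //.
have Gge := card_separates CP DP neCD; rewrite -/T -/G in Gge.
have e1 := expR_ge1Dx (- (4 * B ^+ 2)^-1).
apply: le_trans (ler_wpM2r (ler0n _ _) e1).
rewrite mulrDl mul1r mulNr cT natrX; lra.
Qed.

End SeparationProbability.

(** * The algorithm, its query bounds and its success probability *)

Section Algorithm.

Variable R : realType.

Lemma sum_uniform (T : finType) : (0 < #|T|)%N ->
  \sum_(w : T) (#|T|%:R^-1 : R) = 1.
Proof.
by move=> T0; rewrite sumr_const -[LHS]mulr_natl mulfV // pnatr_eq0 -lt0n.
Qed.

Lemma card_seed_gt0 (n s m : nat) :
  (0 < #|{ffun 'I_m -> {ffun 'I_s -> 'I_n.+1}}|)%N.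
Proof. by rewrite !card_ffun !card_ord expn_gt0 expn_gt0. Qed.

(** Queries are indexed by pairs of a point and a sample, flattened through [enum_val] and
    [enum_rank]. The universe has [n.+1] points so that the seed type is inhabited and the uniform
    weights sum to 1. *)
Definition sampling_alg (n s m : nat) : nonadaptive_alg R n.+1 :=
  @NonadaptiveAlg R n.+1 {ffun 'I_m -> {ffun 'I_s -> 'I_n.+1}}
    (fun=> #|{ffun 'I_m -> {ffun 'I_s -> 'I_n.+1}}|%:R^-1)
    (fun=> ltac:(by rewrite invr_ge0))
    (sum_uniform (card_seed_gt0 n s m))
    #|{: 'I_n.+1 * 'I_m}|
    (fun w => [tuple (enum_val i).1 |: points (w (enum_val i).2)
                | i < #|{: 'I_n.+1 * 'I_m}|])
    (fun _ ans => preim_partition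
       (fun x => [ffun j : 'I_m => tnth ans (enum_rank (x, j))]) [set: _]).

Lemma card_unit_gt0 : (0 < #|{: unit}|)%N.
Proof. by rewrite card_unit. Qed.

Definition trivial_alg (n : nat) : nonadaptive_alg R n :=
  @NonadaptiveAlg R n unit (fun=> #|{: unit}|%:R^-1)
    (fun=> ltac:(by rewrite invr_ge0))
    (sum_uniform card_unit_gt0) 0 (fun=> [tuple]) (fun _ _ => [set setT]).

Lemma success_pr_ge0 (n : nat) (A : nonadaptive_alg R n) P :
  0 <= success_pr A P.
Proof. by apply: sumr_ge0 => w _; apply: seed_pr_ge0. Qed.

Lemma trivial_alg_success (n : nat) (P : {set {set 'I_n}}) :
  clustering 1 P -> success_pr (trivial_alg n) P = 1.
Proof.
move=> /andP[/and3P[/eqP covP _ _] /cards1P[C PC]].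
have PT : P = [set setT] by rewrite PC -covP PC /cover big_set1.
rewrite -(seed_pr_sum1 (trivial_alg n)) /success_pr; apply: eq_bigl => w.
by rewrite /output /= PT eqxx.
Qed.

Lemma sampling_alg_output (n s m : nat) (P : {set {set 'I_n.+1}})
    (w : {ffun 'I_m -> {ffun 'I_s -> 'I_n.+1}}) :
  finset.partition P [set: 'I_n.+1] ->
  (forall C D, C \in P -> D \in P -> C != D ->
     exists j, separates (points (w j)) C D) ->
  output (A := sampling_alg n s m) P w = P.
Proof.
move=> partP /(preim_partition_signature partP) {2}<-.
rewrite /output /=; apply: eq_imset => x; apply/setP => y; rewrite !inE /=.
by congr (_ == _); apply/ffunP => j;
  rewrite !ffunE tnth_map tnth_mktuple enum_rankK.
Qed.

Lemma sampling_alg_query_size (n s m : nat) (w : seed (sampling_alg n s m))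
    (S : {set 'I_n.+1}) :
  S \in queries w -> (#|S| <= s.+1)%N.
Proof.
move=> /mapP[i _ ->]; rewrite cardsU1.
exact: leq_add (leq_b1 _) (card_points _).
Qed.

Lemma sampling_alg_success (n k s m : nat) (B : R) (P : {set {set 'I_n.+1}}) :
  (0 < k)%N -> 1 <= B -> clustering k P -> balanced k B P ->
  s%:R <= k%:R / (4 * B) -> k%:R / (4 * B) <= s.+1%:R ->
  1 - k%:R ^+ 2 * expR (- (m%:R / (4 * B ^+ 2))) <=
  success_pr (sampling_alg n s.+1 m) P.
Proof.
move=> k0 B1 clP balP s_le s_ge; have /andP[partP /eqP cardP] := clP.
set A := sampling_alg n s.+1 m.
pose T := {ffun 'I_m -> {ffun 'I_s.+1 -> 'I_n.+1}}.
have T0 : 0 < #|T|%:R :> R by rewrite ltr0n card_seed_gt0.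
pose e : R := expR (- (m%:R / (4 * B ^+ 2))).
(* The total mass 1 splits into success and failure, leaving a bound on the failure mass. *)
rewrite -[X in X - _](seed_pr_sum1 A) (bigID (fun w => output P w == P)) /=.
rewrite lerBlDr; apply: lerD; first exact: lexx.
rewrite -/e -/T sumr_const -[leLHS]mulr_natl ler_pdivrMr //.
pose bad (p : {set 'I_n.+1} * {set 'I_n.+1}) :=
  [set w : T | [forall j, ~~ separates (points (w j)) p.1 p.2]].
pose pairs := [set p in finset.setX P P | p.1 != p.2].
(* Union bound: a seed with wrong output leaves some ordered pair of distinct blocks unseparated,
   and there are at most [k ^ 2] such pairs. *)
apply: (@le_trans _ _ (\sum_(p in pairs) #|bad p|)%:R).
  rewrite ler_nat; apply: leq_trans (leq_card_bigcup _ bad).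
  apply: subset_leq_card; apply/subsetP => w wbad; apply/negP => nw.
  move: wbad; rewrite -topredE /= => /eqP; apply.
  apply: sampling_alg_output => // C D CP DP neCD.
  apply/existsP; rewrite -[X in is_true X]negbK; apply/negP => nex.
  apply: nw; apply/bigcupP; exists (C, D); first by rewrite !inE CP DP.
  by rewrite inE -negb_exists.
rewrite natr_sum; apply: (@le_trans _ _ (\sum_(p in pairs) (e * #|T|%:R))).
  apply: ler_sum => -[C D]; rewrite !inE => /andP[/andP[/= CP DP] neCD].
  by apply: (card_never_separates (k := k) (P := P)).
rewrite sumr_const -[leLHS]mulr_natl -mulrA ler_wpM2r ?mulr_ge0 ?expR_ge0 //.
rewrite -natrX ler_nat -{1}cardP -mulnn -cardsX.
by apply: subset_leq_card; apply/subsetP => p; rewrite inE => /andP[].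
Qed.

(** The factor 8 is twice the 4 of the separation exponent, so that each pair fails with probability
    at most [(delta / k) ^ 2]. No query is made when [k = 1], where the size bound [k ln k] is 0,
    nor when [delta >= 1], where [ln (k / delta)] may vanish. *)
Definition clustering_alg (n k : nat) (B delta : R) : nonadaptive_alg R n :=
  match n with
  | 0%N => trivial_alg 0
  | n'.+1 =>
    if (1 < k)%N && (delta < 1) then
      sampling_alg n' (Num.truncn (k%:R / (4 * B))).+1
        (Num.truncn (8 * B ^+ 2 * ln (k%:R / delta))).+1
    else trivial_alg n'.+1
  end.

Lemma ln2_gt0 : 0 < ln 2 :> R.
Proof. by apply: ln_gt0; rewrite ltr1n. Qed.

Lemma ln2_le_nat (k : nat) : (1 < k)%N -> ln 2 <= ln k%:R :> R.
Proof. by move=> k1; rewrite ler_ln ?posrE ?ltr0n ?ler_nat // ltnW. Qed.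

Lemma ln_nat_div_ge (k : nat) (delta : R) : (0 < k)%N -> 0 < delta ->
  delta < 1 -> ln k%:R <= ln (k%:R / delta).
Proof.
move=> k0 d0 d1; rewrite ler_ln ?posrE ?divr_gt0 ?ltr0n //.
by rewrite ler_pdivlMr // ler_piMr // ltW.
Qed.

(** The 8 comes from the number of samples; [(ln 2)^-1] absorbs the rounding up, since
    [ln 2 <= B ^+ 2 * ln (k / delta)] for [k >= 2] and [delta < 1]. *)
Definition query_const : R := 8 + (ln 2)^-1.

Lemma query_const_gt0 : 0 < query_const.
Proof. by rewrite addr_gt0 // invr_gt0 ln2_gt0. Qed.

Lemma clustering_alg_nqueries (n k : nat) (B delta : R) :
  (0 < k)%N -> 1 <= B -> 0 < delta ->
  (nqueries (clustering_alg n k B delta))%:R <=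
  query_const * (if (1 < k)%N && (delta < 1)
                 then B ^+ 2 * n%:R * ln (k%:R / delta) else 0).
Proof.
move=> k0 B1 d0; case: n => [|n] /=.
  by rewrite mulr0 mul0r if_same mulr0.
case: ifP => [/andP[k1 d1]|_] /=; last by rewrite mulr0.
rewrite card_prod !card_ord natrM.
set L := ln _; have L2 : ln 2 <= L.
  by apply: le_trans (ln2_le_nat k1) (ln_nat_div_ge _ _ _).
have L0 : 0 < L by apply: lt_le_trans ln2_gt0 L2.
have BB : 1 <= B ^+ 2 by rewrite exprn_ege1.
have x0 : 0 <= 8 * B ^+ 2 * L by rewrite !mulr_ge0 // ltW //; lra.
have /andP[tr _] := truncn_itv x0.
have one : 1 <= (ln 2)^-1 * (B ^+ 2 * L).
  rewrite mulrC ler_pdivlMr ?ln2_gt0 // mul1r; apply: le_trans L2 _.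
  by rewrite ler_peMl // ltW.
have -> : query_const * (B ^+ 2 * n.+1%:R * L) =
    n.+1%:R * (8 * B ^+ 2 * L + (ln 2)^-1 * (B ^+ 2 * L)).
  by rewrite /query_const; ring.
by rewrite ler_wpM2l // -natr1 lerD.
Qed.

Lemma clustering_alg_query_size (n k : nat) (B delta : R) :
  1 <= B -> forall (w : seed (clustering_alg n k B delta)) (S : {set 'I_n}),
  S \in queries w -> #|S|%:R <= (3 * (ln 2)^-1) * (k%:R * ln k%:R) :> R.
Proof.
move=> B1; case: n => [|n] //=; case: ifP => [/andP[k1 d1]|_] //= w S Sw.
have K1 : 1 <= k%:R :> R by rewrite ler1n ltnW.
have x0 : 0 <= k%:R / (4 * B) by rewrite divr_ge0 //; lra.
have /andP[tr _] := truncn_itv x0.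
have xk : k%:R / (4 * B) <= k%:R.
  by rewrite ler_pdivrMr ?ler_peMr //; lra.
have := sampling_alg_query_size Sw; rewrite -(ler_nat R) => /le_trans; apply.
(* The sample has at most [k / (4 B) + 1] points and the queried point adds one; each of the three
   summands is at most [k]. *)
apply: (@le_trans _ _ (3 * k%:R)); first by rewrite -natr1 -natr1; lra.
rewrite -mulrA ler_wpM2l // mulrCA ler_peMr //.
by rewrite mulrC ler_pdivlMr ?ln2_gt0 // mul1r ln2_le_nat.
Qed.

Lemma clustering_alg_success (n k : nat) (B delta : R) (P : {set {set 'I_n}}) :
  (0 < k)%N -> 1 <= B -> 0 < delta -> clustering k P -> balanced k B P ->
  1 - delta <= success_pr (clustering_alg n k B delta) P.
Proof.
move=> k0 B1 d0 clP balP.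
have [d1|d1] := leP 1 delta.
  by apply: le_trans (success_pr_ge0 _ _); lra.
case: n P clP balP => [|n] P clP balP.
  (* Over an empty universe a block would be the empty set, which a partition excludes, so [k > 0]
     is contradicted. *)
  case/andP: clP => /and3P[_ _ P0] /eqP cP.
  have : (0 < #|P|)%N by rewrite cP.
  case/card_gt0P => C CP; suff C0 : C = set0 by rewrite -C0 CP in P0.
  by apply/setP => -[].
rewrite /= d1 andbT; case: ifPn => k1; last first.
  have kE : k = 1%N by apply/eqP; rewrite eqn_leq k0 leqNgt k1.
  by rewrite kE in clP; rewrite trivial_alg_success //; lra.
have K0 : 0 < k%:R :> R by rewrite ltr0n.
have x0 : 0 <= k%:R / (4 * B) by rewrite divr_ge0 // ?ltW //; lra.
have /andP[s1 s2] := truncn_itv x0.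
set m := (Num.truncn (8 * _ * _)).+1.
apply: le_trans (sampling_alg_success m k0 B1 clP balP s1 (ltW s2)).
rewrite lerB //.
set L := ln (k%:R / delta) in m *.
have L0 : 0 <= L.
  by apply: le_trans (ltW ln2_gt0)
    (le_trans (ln2_le_nat k1) (ln_nat_div_ge _ _ _)).
have BB : 1 <= B ^+ 2 by rewrite exprn_ege1.
have y0 : 0 <= 8 * B ^+ 2 * L by rewrite !mulr_ge0 //; lra.
have /andP[_ m2] := truncn_itv y0.
have em : expR (- (m%:R / (4 * B ^+ 2))) <= expR (2%:R * - L).
  rewrite ler_expR mulrN lerN2 ler_pdivlMr; last lra.
  by apply: ltW; apply: le_lt_trans m2; rewrite le_eqVlt; apply/orP; left;
    apply/eqP; ring.
apply: le_trans (ler_wpM2l (exprn_ge0 _ (ltW K0)) em) _.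
(* The bound collapses to [(k * (delta / k)) ^+ 2 = delta ^+ 2], which is at most [delta]. *)
rewrite expRM_natl -exprMn expRN lnK ?posrE ?divr_gt0 // invf_div.
rewrite mulrCA mulfV ?gt_eqF // mulr1 expr2 ler_piMl // ltW //.
Qed.

End Algorithm.

(** * Inverse polynomial error and the final bounds *)

Lemma ln_inverse_poly (R : realType) (delta : nat -> R) :
  inverse_poly delta -> exists c : R, 0 <= c /\
    forall k : nat, (1 < k)%N -> ln (k%:R / delta k) <= c * ln k%:R.
Proof.
move=> [d0 [a [p dP]]].
(* Positivity of [a] is read off at [k = 1], where the polynomial bound is [a] itself. *)
have a0 : 0 < a.
  have := dP 1%N isT; rewrite expr1n mulr1; apply: lt_le_trans.
  by rewrite invr_gt0 d0.
have l2 := ln2_gt0 R.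
(* From [k / delta k <= a * k ^ p.+1], the logarithm is at most [ln a + p.+1 * ln k]; the constant
   is absorbed using [ln 2 <= ln k]. *)
exists (`|ln a| / ln 2 + p.+1%:R); split.
  by rewrite addr_ge0 // divr_ge0 // ltW.
move=> k k1; have k0 : (0 < k)%N by apply: ltnW.
have K0 : 0 < k%:R :> R by rewrite ltr0n.
apply: (@le_trans _ _ (ln (a * k%:R ^+ p.+1))).
  rewrite ler_ln ?posrE ?divr_gt0 ?mulr_gt0 ?exprn_gt0 ?d0 //.
  by rewrite exprS mulrCA; apply: ler_wpM2l (ltW K0) _ _ (dP _ k0).
rewrite lnM ?posrE ?exprn_gt0 // lnXn // mulrDl mulr_natl lerD2r.
apply: le_trans (ler_norm _) _; rewrite -mulrA ler_peMr //.
by rewrite mulrC ler_pdivlMr // mul1r ln2_le_nat.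
Qed.

Theorem theorem4p2 (R : realType) :
  exists A : forall (n k : nat) (B delta : R), nonadaptive_alg R n,
    (exists c : R, 0 < c /\
      forall (n k : nat) (B delta : R), (0 < k)%N -> 1 <= B -> 0 < delta ->
        [/\ forall P : {set {set 'I_n}}, clustering k P -> balanced k B P ->
              1 - delta <= success_pr (A n k B delta) P,
            (nqueries (A n k B delta))%:R
              <= c * `|B ^+ 2 * n%:R * ln (k%:R / delta)|
                 + c * `|B * k%:R * ln (k%:R / delta) ^+ 4|
          & forall (w : seed (A n k B delta)) (S : {set 'I_n}),
              S \in queries w -> #|S|%:R <= c * `|k%:R * ln k%:R|]) /\
    (forall (B : R) (delta : nat -> R) (K : R),
      1 <= B -> inverse_poly delta ->
      exists c : R, 0 < c /\
        forall n k : nat, (1 < n)%N -> (0 < k)%N ->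
          k%:R <= K * (n%:R / ln n%:R ^+ 3) ->
          (nqueries (A n k B (delta k)))%:R <= c * `|n%:R * ln k%:R|).
Proof.
have l2 : 0 < (ln 2)^-1 :> R by rewrite invr_gt0 ln2_gt0.
exists (@clustering_alg R); split.
  (* One constant dominates both the query count and the query size. *)
  pose c : R := query_const R + 3 * (ln 2)^-1.
  have c0 := query_const_gt0 R.
  exists c; split=> [|n k B delta k0 B1 d0]; first by rewrite /c; lra.
  split=> [P||w S Sw]; first exact: clustering_alg_success.
    apply: le_trans (clustering_alg_nqueries n k0 B1 d0) _.
    apply: ler_wpDr; first by rewrite mulr_ge0 // /c; lra.
    apply: ler_pM; rewrite ?(ltW c0) //; [|by rewrite /c; lra|].
      case: ifP => // /andP[k1 d1]; rewrite !mulr_ge0 //; try lra.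
      by apply: le_trans (ln_nat_div_ge k0 d0 d1); rewrite ln_ge0 // ler1n.
    by case: ifP => // _; apply: ler_norm.
  apply: le_trans (clustering_alg_query_size B1 Sw) _.
  apply: ler_pM; rewrite ?ler_norm ?mulr_ge0 ?(ltW l2) //.
    by case: k {Sw w} k0 => // k _; rewrite ln_ge0 // ler1n.
  by rewrite /c; lra.
move=> B delta K B1 ipd; have [c [c0 cP]] := ln_inverse_poly ipd.
have q0 := query_const_gt0 R.
(* The constant [c] bounds [ln (k / delta k)] against [ln k] and may be 0; adding 1 makes the
   witness positive. *)
exists (query_const R * (B ^+ 2 * (c + 1))); split.
  by rewrite !mulr_gt0 ?exprn_gt0 //; lra.
move=> n k _ k0 _; have d0 : 0 < delta k by case: ipd => h _; apply: h.
apply: le_trans (clustering_alg_nqueries n k0 B1 d0) _.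
have lk0 : 0 <= ln k%:R :> R by rewrite ln_ge0 // ler1n.
rewrite -[leRHS]mulrA ler_wpM2l ?(ltW q0) //.
rewrite ger0_norm ?mulr_ge0 //.
case: ifP => [/andP[k1 d1]|_]; last by rewrite !mulr_ge0 ?exprn_ge0 //; lra.
have B2 : 0 <= B ^+ 2 by rewrite exprn_ge0 //; lra.
rewrite -[leLHS]mulrA -[leRHS]mulrA ler_wpM2l // [leRHS]mulrCA ler_wpM2l //.
by apply: le_trans (cP _ k1) _; rewrite ler_wpM2r //; lra.
Qed.
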